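(* Let $G$ be a graph with $n$ vertices and let $P = \{p_1, p_2, \ldots, p_k\} \subseteq [n]$ be a pinnacle set of $G$ with $p_1 < p_2 < \cdots < p_k$. Let $Q = \{q_1, q_2, \ldots, q_k\}$ be another subset of $[n]$ with $q_1 < q_2 < \cdots < q_k$. If $p_i \le q_i$ for all $1 \le i \le k$, then $Q$ is a pinnacle set of $G$ as well.
   Context: Graphs are finite and simple, and $[n] = \{1,2,\ldots,n\}$. A labeling of a graph $G$ with $n$ vertices is a bijection $\lambda : V(G) \to [n]$. The label $\lambda(u)$ of a vertex $u$ is a pinnacle of $(G,\lambda)$ if $\lambda(u) > \lambda(v)$ for every neighbor $v$ of $u$ (so the label of an isolated vertex is vacuously a pinnacle). The pinnacle set of $(G,\lambda)$ is the set of all pinnacles of $(G,\lambda)$. A subset $S \subseteq [n]$ is a pinnacle set of $G$ if there is a labeling $\lambda$ of $G$ such that $S$ is the pinnacle set of $(G,\lambda)$. *)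

(* Defs.v *)
From mathcomp Require Import all_boot finmap.

Set Implicit Arguments.
Unset Strict Implicit.
Unset Printing Implicit Defensive.

Local Open Scope fset_scope.

(* The set [n] = {1, ..., n}. *)
Definition labels (n : nat) : {fset nat} := [fset i in iota 1 n].

(* A finite simple graph is a symmetric irreflexive relation [adj] on a
   finType [V]. A labeling is encoded as a nat-valued function; the two
   conditions say that it is a bijection from [V] onto {1, ..., #|V|}. *)
Definition labeling (V : finType) (lambda : V -> nat) : Prop :=
  injective lambda /\ [fset lambda u | u in V] = labels #|V|.

Definition is_pinnacle (V : finType) (adj : rel V) (lambda : V -> nat)
    (u : V) : bool :=
  [forall v, adj u v ==> (lambda v < lambda u)].

Definition pinnacles (V : finType) (adj : rel V) (lambda : V -> nat) :
    {fset nat} :=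
  [fset lambda u | u in V & is_pinnacle adj lambda u].

Definition pinnacle_set (V : finType) (adj : rel V) (S : {fset nat}) : Prop :=
  S `<=` labels #|V| /\
  exists2 lambda : V -> nat, labeling lambda & pinnacles adj lambda = S.

(* Main.v *)
Require Import Defs.
From mathcomp Require Import all_boot finmap.
From mathcomp Require Import zify.

(** A pinnacle label can be pushed up one unit at a time. If [m < #|V|] is a
pinnacle, carried by [u], and [w] carries [m.+1], then [u] and [w] are not
adjacent, because the neighbors of [u] have smaller labels. Exchanging the
labels of [u] and [w] changes the order of no other pair of labels, so every
edge keeps its larger end and the vertices that carry pinnacles stay the same
([pinnacle_set_next_swap]); the pinnacle set is merely transported by the
transposition of [m] and [m.+1].

To go from [p] to [q], raise the entry [p i] at the largest index [i] with
[p i < q i]. Its successor is not a later entry of [p]: these equal the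
corresponding entries of [q], hence exceed [q i], which is at least
[(p i).+1]. So the raised sequence is still increasing and below [q], and the
transposition acts on [P] by changing [p i] only. Induction on the total gap
[\sum_i (q i - p i)] concludes ([pinnacle_set_raise]). *)

Local Open Scope fset_scope.

Definition next_swap (m a : nat) : nat :=
  if a == m then m.+1 else if a == m.+1 then m else a.

Lemma next_swapK m : involutive (next_swap m).
Proof. by move=> a; rewrite /next_swap; repeat case: ifP; lia. Qed.

Lemma next_swap_lt m a b :
  ~ (a = m /\ b = m.+1) -> ~ (a = m.+1 /\ b = m) ->
  (next_swap m a < next_swap m b) = (a < b).
Proof. by rewrite /next_swap; repeat case: ifP; lia. Qed.

Lemma mem_labels n a : (a \in labels n) = (0 < a <= n).
Proof. by rewrite !inE /= mem_iota add1n ltnS. Qed.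

Lemma labels_next_swap m n a : 0 < m < n ->
  (next_swap m a \in labels n) = (a \in labels n).
Proof. by rewrite !mem_labels /next_swap; repeat case: ifP; lia. Qed.

Lemma labeling_next_swap (V : finType) (lambda : V -> nat) m :
  0 < m < #|V| -> labeling lambda -> labeling (next_swap m \o lambda).
Proof.
move=> hm [lam_inj lam_im]; split.
  exact: inj_comp (inv_inj (next_swapK m)) lam_inj.
apply/fsetP=> a; rewrite -(labels_next_swap m _ a hm) -lam_im.
apply/imfsetP/imfsetP=> -[u _ /= e]; exists u => //=.
  by rewrite e next_swapK.
by rewrite -e next_swapK.
Qed.

(** An edge cannot carry the labels [m] and [m.+1], since [m] is a pinnacle;
so the transposition preserves the order of the labels along every edge. *)
Lemma is_pinnacle_next_swap (V : finType) (adj : rel V) (lambda : V -> nat) m :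
  symmetric adj -> injective lambda -> m \in pinnacles adj lambda ->
  is_pinnacle adj (next_swap m \o lambda) =1 is_pinnacle adj lambda.
Proof.
move=> adj_sym lam_inj /imfsetP[u /=]; rewrite inE /= => /forallP u_pin def_m x.
have not_edge y z : adj y z -> ~ (lambda y = m /\ lambda z = m.+1).
  move=> yz [ym zm]; have yu : y = u by apply: lam_inj; rewrite ym.
  by have := u_pin z; rewrite -yu yz /= ym zm ltnNge leqnSn.
apply: eq_forallb => y /=; case xy: (adj x y) => //=.
rewrite next_swap_lt // => e; first by apply: (not_edge y x); rewrite // adj_sym.
by case: e => ym xm; apply: (not_edge x y).
Qed.

(** When [m.+1] is not in [S], the new set is [S] with [m] raised to [m.+1];
when it is, the new set is [S] itself. *)
Lemma pinnacle_set_next_swap (V : finType) (adj : rel V) (S : {fset nat}) m :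
  symmetric adj -> m \in S -> m < #|V| -> pinnacle_set adj S ->
  pinnacle_set adj [fset next_swap m a | a in S].
Proof.
move=> adj_sym mS mn [Sn [lambda lam_lab lam_pin]].
have hm : 0 < m < #|V|.
  by rewrite mn andbT; move: (fsubsetP Sn m mS); rewrite mem_labels; case/andP.
split.
  apply/fsubsetP=> _ /imfsetP[a /= aS ->].
  by rewrite labels_next_swap // (fsubsetP Sn).
exists (next_swap m \o lambda); first exact: labeling_next_swap.
have same : is_pinnacle adj (next_swap m \o lambda) =1 is_pinnacle adj lambda.
  by apply: is_pinnacle_next_swap => //; [case: lam_lab | rewrite lam_pin].
rewrite -lam_pin; apply/fsetP=> a; apply/imfsetP/imfsetP => /= -[].
  move=> u; rewrite inE /= same => hu ->; exists (lambda u) => //.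
  by apply/imfsetP; exists u; rewrite //= inE.
move=> _ /imfsetP[u /= hu ->] ->; exists u => //.
by move: hu; rewrite !inE /= same.
Qed.

(** Among the indices with [p i < q i] the largest one must be raised first:
for a smaller one, [(p i).+1] may be the next entry of [p]. *)
Lemma pinnacle_set_raise (V : finType) (adj : rel V) (k : nat)
    (p q : 'I_k -> nat) :
  symmetric adj ->
  (forall i j : 'I_k, i < j -> p i < p j) ->
  (forall i j : 'I_k, i < j -> q i < q j) ->
  (forall i, p i <= q i) -> (forall i, q i <= #|V|) ->
  pinnacle_set adj [fset p i | i in 'I_k] ->
  pinnacle_set adj [fset q i | i in 'I_k].
Proof.
move=> adj_sym + q_incr + q_le.
move gapE: (\sum_i (q i - p i)) => gap.
elim/ltn_ind: gap p gapE => gap IH p gapE p_incr pq hP.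
case: (pickP (fun i => p i < q i)) => [i0 lt0 | eq_pq]; last first.
  suff <- : [fset p i | i in 'I_k] = [fset q i | i in 'I_k] by [].
  apply: eq_imfset => // i; apply/eqP.
  by rewrite eqn_leq pq leqNgt eq_pq.
case: (@arg_maxnP _ i0 (fun i => p i < q i) (fun i : 'I_k => i : nat) lt0) => i lt_i i_max {i0 lt0}.
(* Beyond [i] the two sequences agree, which leaves room for [(p i).+1]. *)
have i_late (j : 'I_k) : i < j -> (p i).+1 < p j.
  move=> ij; apply: leq_trans (_ : q j <= p j); last first.
    by rewrite leqNgt; apply/negP => /i_max; rewrite /= leqNgt ij.
  by apply: leq_ltn_trans (q_incr _ _ ij).
have p_inj (j : 'I_k) : p j = p i -> j = i.
  move=> e; apply/val_inj/eqP; case: (ltngtP j i) => //= /p_incr.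
    by rewrite e ltnn.
  by rewrite e ltnn.
pose p' j := next_swap (p i) (p j).
have p'E j : p' j = if j == i then (p i).+1 else p j.
  rewrite /p' /next_swap; case: (eqVneq j i) => [-> | ji]; first by rewrite eqxx.
  rewrite ifN; last by apply: contra_neq ji => /p_inj.
  rewrite ifN //; case: (ltngtP j i) => [/p_incr | /i_late | /val_inj e].
  - by rewrite neq_ltn => /leqW ->.
  - by rewrite neq_ltn => ->; rewrite orbT.
  - by rewrite e eqxx in ji.
apply: (IH (\sum_j (q j - p' j)) _ p' erefl).
- rewrite -gapE (bigD1 i) //= [X in _ < X](bigD1 i) //= p'E eqxx.
  rewrite -addSn leq_add //; first by lia.
  by apply: leq_sum => j ji; rewrite p'E (negbTE ji).
- move=> j l jl; rewrite !p'E.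
  case: (eqVneq j i) => [ji|_]; case: (eqVneq l i) => [li|_].
  + by rewrite ji li ltnn in jl.
  + by apply: i_late; rewrite -ji.
  + by rewrite -li; apply/leqW/p_incr.
  + exact: p_incr.
- by move=> j; rewrite p'E; case: eqVneq => [->|].
- have -> : [fset p' j | j in 'I_k] =
            [fset next_swap (p i) a | a in [fset p j | j in 'I_k]].
    apply/fsetP=> a; apply/imfsetP/imfsetP => /= -[].
      by move=> j _ ->; exists (p j) => //; apply/imfsetP; exists j.
    by move=> _ /imfsetP[j /= _ ->] ->; exists j.
  apply: pinnacle_set_next_swap => //; first by apply/imfsetP; exists i.
  exact: leq_trans lt_i (q_le i).
Qed.

Theorem theorem4p2 (V : finType) (adj : rel V)
    (adj_sym : symmetric adj) (adj_irr : irreflexive adj)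
    (n : nat) (hn : #|V| = n) (k : nat) (P Q : {fset nat}) (p q : 'I_k -> nat)
    (hPn : P `<=` labels n) (hP : pinnacle_set adj P)
    (hPp : P = [fset p i | i in 'I_k])
    (hp : forall i j : 'I_k, i < j -> p i < p j)
    (hQn : Q `<=` labels n)
    (hQq : Q = [fset q i | i in 'I_k])
    (hq : forall i j : 'I_k, i < j -> q i < q j)
    (hpq : forall i : 'I_k, p i <= q i) :
  pinnacle_set adj Q.
Proof.
have q_le i : q i <= #|V|.
  have /(fsubsetP hQn) : q i \in Q by rewrite hQq; apply/imfsetP; exists i.
  by rewrite mem_labels hn => /andP[].
by rewrite hQq; apply: (@pinnacle_set_raise _ _ _ p); rewrite -?hPp.
Qed.
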